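(* Let $q=mf+1$ be a power of a prime, with $m,f$ positive integers, and suppose $m$ is even. Consider the system of equations $$ \begin{cases} \sum\limits_{t=0}^{2s}(-1)^tg_tg_{2s-t}+\sum\limits_{t=2s+1}^{m-1}(-1)^tg_tg_{m+2s-t}=0,\quad s=1,\dots,\frac{m}{2}-1,\\ g_sg_{m-s}=(-1)^s,\quad s=1,\dots,\frac{m}{2},\\ h^sg_sg_{\frac{m}{2}+s}=g_{2s}g_{\frac{m}{2}},\quad s=1,\dots,\frac{m}{2}-1,\\ h^{\frac{m}{2}}=1 \end{cases} $$ in the unknowns $g_0,g_1,\dots,g_{m-1},h$. If $H_{q,m}$ is a difference set in $\mathbb{F}_q$, then this system has a solution $(g_0,g_1,\dots,g_{m-1},h)\in\mathbb{R}\times(\mathbb{S}^1)^m$ with $g_0=-1/\sqrt{q}$. If $M_{q,m}$ is a difference set in $\mathbb{F}_q$, then this system has a solution $(g_0,g_1,\dots,g_{m-1},h)\in\mathbb{R}\times(\mathbb{S}^1)^m$ with $g_0=(m-1)/\sqrt{q}$.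
   Context: $H_{q,m}$ denotes the set of nonzero $m$th powers in $\mathbb{F}_q$ and $M_{q,m}=H_{q,m}\cup\{0\}$. A subset $D\subseteq\mathbb{F}_q$ is a difference set in $\mathbb{F}_q$ if there is an integer $\lambda$ such that for each nonzero $a\in\mathbb{F}_q$ there are exactly $\lambda$ ordered pairs $(x,y)\in D\times D$ with $x-y=a$. $\mathbb{S}^1=\{z\in\mathbb{C}\mid |z|=1\}$. *)

(* Defs.v *)
From HB Require Import structures.
From mathcomp Require Import all_boot all_order all_algebra.
From mathcomp Require Import reals.
From mathcomp Require Import complex.

Set Implicit Arguments.
Unset Strict Implicit.
Unset Printing Implicit Defensive.

Import Order.TTheory GRing.Theory Num.Theory.
Local Open Scope ring_scope.
Local Open Scope complex_scope.

Definition nonzero_powers (F : finFieldType) (m : nat) : {set F} :=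
  [set x ^+ m | x : F] :\ 0.

Definition powers_with_zero (F : finFieldType) (m : nat) : {set F} :=
  0 |: nonzero_powers F m.

Definition difference_set (F : finFieldType) (D : {set F}) : Prop :=
  exists lambda : nat, forall a : F, a != 0 ->
    #|[set xy in setX D D | xy.1 - xy.2 == a]| = lambda.

(* Every index below is at most m.-1 when m is even and positive, so neither
   truncated subtraction nor the default value of nth plays a role. *)
Definition is_solution (R : realType) (m : nat)
    (g : m.-tuple R[i]) (h : R[i]) : Prop :=
  [/\ forall s : nat, (1 <= s <= m./2 - 1)%N ->
        \sum_(0 <= t < (2 * s).+1) (-1) ^+ t * g`_t * g`_(2 * s - t)
        + \sum_((2 * s).+1 <= t < m) (-1) ^+ t * g`_t * g`_(m + 2 * s - t) = 0,
      forall s : nat, (1 <= s <= m./2)%N -> g`_s * g`_(m - s) = (-1) ^+ s,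
      forall s : nat, (1 <= s <= m./2 - 1)%N ->
        h ^+ s * g`_s * g`_(m./2 + s) = g`_(2 * s) * g`_(m./2)
    & h ^+ m./2 = 1].

Definition unit_circle (R : realType) (z : R[i]) : Prop := `|z| = 1.

Definition in_domain (R : realType) (m : nat)
    (g : m.-tuple R[i]) (h : R[i]) : Prop :=
  [/\ g`_0 \is Num.real,
      forall s : nat, (1 <= s <= m - 1)%N -> unit_circle g`_s
    & unit_circle h].

(* Main.v *)
Require Import Defs.
From HB Require Import structures.
From mathcomp Require Import all_boot all_order all_algebra.
From mathcomp Require Import all_fingroup all_solvable.
From mathcomp Require Import separable cyclotomic finfield ring zify.
From mathcomp Require Import reals.
From mathcomp Require Import complex.

(** Fix a multiplicative character [chi] of [F] of exact order [m] and a nontrivial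
additive character [psi].  For [0 < s < m], the unknown [g_s] is solved by the
Gauss sum [G(chi^s)] divided by [sqrt q], and [h] by [chi 4].  Each block of the
system is then a classical property of Gauss sums.

- [|g_s| = 1] is the evaluation [norm_gauss_sum] of [|G(chi^s)|^2] as [q].
- [g_s g_(m-s) = (-1)^s] is the reflection formula [gauss_sum_inv], which gives
  [chi^s(-1)].  Counting differences shows that [f] is odd
  ([odd_residue_degree]), so that [-1] is not an [m]-th power and
  [chi(-1) = -1] ([char_minus1]).
- The equations that involve [h] are the Hasse-Davenport product formula for the
  quadratic character [phi = chi^(m/2)] ([gauss_sum_duplication]).  It follows
  from the Jacobi sum identity [J(chi, chi) = chi(4)^-1 J(chi, phi)], itself
  obtained by completing the square.
- The equations that sum over [t] express the difference set property.  Let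
  [D] be either of the two sets and [eta(b)] the sum of [psi(b x)] over [D].
  For [b != 0], the product [eta(b) eta(-b)] collects [psi(b a)] over the
  differences [a] of [D], so it does not depend on [b] ([diff_set_fourier]).  On
  the other hand [m eta(1/b)] is a polynomial in [z = chi(b)] with coefficients
  [G(chi^s)] ([period_expansion]); only its constant coefficient sees whether [0]
  is in [D], and it is [-1] or [m - 1].  Replacing [b] by [-b] replaces [z] by
  [-z], so the product of the polynomials at [z] and [-z] is constant over the
  [m]-th roots of unity, and the nonconstant coefficients of its reduction modulo
  [z^m - 1] vanish ([cyclic_convolution_const]). *)

Set Implicit Arguments.
Unset Strict Implicit.
Unset Printing Implicit Defensive.

Import Order.TTheory GRing.Theory Num.Theory.
Local Open Scope ring_scope.

(** * Multiplicative characters and Jacobi sums *)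

Section MultiplicativeCharacters.
Variables (F : finFieldType) (C : fieldType).
Implicit Types (chi : F -> C) (x y : F).

Lemma eq_mull_neq1 (a s : C) : a != 1 -> s = a * s -> s = 0.
Proof.
move=> a1 /eqP; rewrite -subr_eq0 -{1}[s]mul1r -mulrBl mulf_eq0 subr_eq0.
by rewrite [1 == a]eq_sym (negPf a1) => /eqP.
Qed.

Definition nontrivial_char chi := exists2 a, a != 0 & chi a != 1.

Lemma mul_char_exp chi n :
  GRing.monoid_morphism chi -> GRing.monoid_morphism (fun x => chi x ^+ n).
Proof.
by move=> [chi1 chiM]; split=> [|x y]; rewrite ?chi1 ?expr1n // chiM exprMn.
Qed.

Lemma mul_char_mul chi chi' :
  GRing.monoid_morphism chi -> GRing.monoid_morphism chi' ->
  GRing.monoid_morphism (fun x => chi x * chi' x).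
Proof.
move=> [chi1 chiM] [chi'1 chi'M]; split=> [|x y]; first by rewrite chi1 chi'1 mulr1.
by rewrite chiM chi'M mulrACA.
Qed.

Lemma mul_char_inv chi :
  GRing.monoid_morphism chi -> GRing.monoid_morphism (fun x => (chi x)^-1).
Proof. by move=> [chi1 chiM]; split=> [|x y]; rewrite ?chi1 ?invr1 // chiM invfM. Qed.

Lemma mul_char_neq0 chi x : GRing.monoid_morphism chi -> x != 0 -> chi x != 0.
Proof.
move=> [chi1 chiM] x0; apply/eqP => chix0; move/eqP: (oner_neq0 C); apply.
by rewrite -chi1 -(divff x0) chiM chix0 mul0r.
Qed.

Lemma mul_charV chi x :
  GRing.monoid_morphism chi -> x != 0 -> chi x^-1 = (chi x)^-1.
Proof.
move=> chi_mor x0; apply: (mulfI (mul_char_neq0 chi_mor x0)).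
by rewrite mulfV ?mul_char_neq0 // -chi_mor.2 mulfV // chi_mor.1.
Qed.

Lemma mul_charX chi x n :
  GRing.monoid_morphism chi -> chi (x ^+ n) = chi x ^+ n.
Proof.
by move=> [chi1 chiM]; elim: n => [|n IH]; rewrite ?expr0 // !exprS chiM IH.
Qed.

(** Characters are multiplicative on the whole of [F], so the trivial one may be [1]
at [0]; by this lemma the others give the same sums over [F] and over its nonzero
elements. *)
Lemma nontrivial_char0 chi :
  GRing.monoid_morphism chi -> nontrivial_char chi -> chi 0 = 0.
Proof.
move=> [_ chiM] [a _ chia]; apply: (eq_mull_neq1 chia).
by rewrite -chiM mulr0.
Qed.

Lemma sum_mul_char chi :
  GRing.monoid_morphism chi -> nontrivial_char chi -> \sum_x chi x = 0.
Proof.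
move=> [_ chiM] [a a0 chia]; apply: (eq_mull_neq1 chia).
rewrite {1}(reindex (fun x => a * x)) /=; last first.
  by exists (fun x => a^-1 * x) => x _; rewrite ?mulKf ?mulVKf.
by rewrite big_distrr; apply: eq_bigr => x _; rewrite chiM.
Qed.

Definition jacobi_sum chi chi' := \sum_x chi x * chi' (1 - x).

Definition quadratic_char chi :=
  chi 0 = 0 /\ forall x, x != 0 -> chi x = if [exists y, x == y ^+ 2] then 1 else -1.

Lemma card_sqrt chi x : (2%:R != 0 :> F) -> quadratic_char chi ->
  #|[pred y : F | y ^+ 2 == x]|%:R = 1 + chi x :> C.
Proof.
move=> char2 [chi0 chiE]; have [->|x0] := eqVneq x 0.
  rewrite chi0 addr0 (eq_card (B := pred1 0)) ?card1 // => y.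
  by rewrite !inE sqrf_eq0.
rewrite chiE //; case: ifPn => [/existsP[y /eqP xE]|/existsPn nsq]; last first.
  rewrite subrr eq_card0 // => y; rewrite !inE eq_sym; exact: negPf.
have y0 : y != 0 by apply: contraNneq x0 => y0; rewrite xE y0 expr0n.
rewrite (eq_card (B := pred2 y (- y))); last by move=> z; rewrite !inE xE eqf_sqr.
have yNy : y != - y by rewrite -addr_eq0 -mulr2n -mulr_natr mulf_neq0.
by rewrite card2 yNy.
Qed.

(** Each [v] has [1 + chi v] square roots. *)
Lemma sum_sqr (f : F -> C) chi : (2%:R != 0 :> F) -> quadratic_char chi ->
  \sum_u f (u ^+ 2) = \sum_v f v * (1 + chi v).
Proof.
move=> char2 chi_quad; rewrite (partition_big (fun u => u ^+ 2) predT) //=.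
apply: eq_bigr => v _; rewrite -(card_sqrt v char2 chi_quad) mulr_natr -sumr_const.
by apply: eq_big => // u /eqP ->.
Qed.

(** With [x = (1 + u) / 2], the product [x (1 - x)] is [(1 - u^2) / 4].  Grouping the
[u] by their square [v] leaves the sum of [chi (1 - v) * (1 + phi v)], whose first
part vanishes. *)
Lemma jacobi_sum_diag chi phi : (2%:R != 0 :> F) ->
  GRing.monoid_morphism chi -> nontrivial_char chi -> quadratic_char phi ->
  jacobi_sum chi chi = (chi 4%:R)^-1 * jacobi_sum chi phi.
Proof.
move=> char2 chi_mor chi_nt phi_quad; have [chi1 chiM] := chi_mor.
have char4 : 4%:R != 0 :> F by rewrite (natrM _ 2 2) mulf_neq0.
rewrite /jacobi_sum (reindex (fun u => (1 + u) / 2%:R)) /=; last first.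
  exists (fun x => x * 2%:R - 1) => x _; first by rewrite divfK // addrC addKr.
  by rewrite addrC subrK mulfK.
transitivity ((chi 4%:R)^-1 * \sum_u chi (1 - u ^+ 2)).
  rewrite big_distrr; apply: eq_bigr => u _; rewrite /= -chiM -mul_charV // -chiM.
  by congr chi; field; rewrite char2 char4.
congr (_ * _); rewrite (sum_sqr (fun v => chi (1 - v)) char2 phi_quad).
rewrite (reindex (fun v => 1 - v)) /=; last first.
  by exists (fun v => 1 - v) => x _; rewrite subKr.
under eq_bigr do rewrite subKr mulrDr mulr1.
by rewrite big_split /= sum_mul_char // add0r.
Qed.

End MultiplicativeCharacters.

(** * Gauss sums *)

Section GaussSums.
Variables (F : finFieldType) (C : fieldType).
Implicit Types (chi psi : F -> C) (x y : F).

Definition additive_char psi := psi 0 = 1 /\ {morph psi : x y / x + y >-> x * y}.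

Definition gauss_sum chi psi := \sum_x chi x * psi x.

Lemma sum_additive_char psi b : additive_char psi -> nontrivial_char psi ->
  b != 0 -> \sum_x psi (b * x) = 0.
Proof.
move=> [psi0 psiD] [a a0 psia] b0.
have -> : \sum_x psi (b * x) = \sum_x psi x.
  rewrite [RHS](reindex (fun x => b * x)) //=.
  by exists (fun x => b^-1 * x) => x _; rewrite ?mulKf ?mulVKf.
apply: (eq_mull_neq1 psia); rewrite {1}(reindex (fun x => a + x)) /=; last first.
  by exists (fun x => - a + x) => x _; rewrite ?addKr ?addNKr.
by rewrite big_distrr; apply: eq_bigr => x _; rewrite psiD.
Qed.

Lemma gauss_sum_scale chi psi b : GRing.monoid_morphism chi -> b != 0 ->
  \sum_x chi x * psi (b * x) = (chi b)^-1 * gauss_sum chi psi.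
Proof.
move=> chi_mor b0; rewrite /gauss_sum [in RHS](reindex (fun x => b * x)) /=; last first.
  by exists (fun x => b^-1 * x) => x _; rewrite ?mulKf ?mulVKf.
rewrite big_distrr; apply: eq_bigr => x _; rewrite /= chi_mor.2 mulrA mulKf //.
exact: mul_char_neq0.
Qed.

(** In the product, collect the terms with [x + y = a].  Scaling by [a != 0] extracts
[chi a * chi' a] from the inner sum; for [a = 0] the inner sum vanishes because
[chi * chi'] is nontrivial. *)
Lemma gauss_sumM chi chi' psi : additive_char psi ->
  GRing.monoid_morphism chi -> GRing.monoid_morphism chi' ->
  nontrivial_char (fun x => chi x * chi' x) ->
  gauss_sum chi psi * gauss_sum chi' psi
    = jacobi_sum chi chi' * gauss_sum (fun x => chi x * chi' x) psi.
Proof.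
move=> [psi0 psiD] chi_mor chi'_mor nt; have mor := mul_char_mul chi_mor chi'_mor.
rewrite [RHS]big_distrr /= [LHS]big_distrl /=.
transitivity (\sum_x \sum_a psi a * (chi x * chi' (a - x))).
  apply: eq_bigr => x _; rewrite big_distrr /= [RHS](reindex (fun y => x + y)) /=.
    by apply: eq_bigr => y _; rewrite psiD addrC addKr mulrACA mulrC.
  by exists (fun y => - x + y) => y _; rewrite ?addKr ?addNKr.
rewrite exchange_big; apply: eq_bigr => a _; rewrite -big_distrr mulrA [RHS]mulrC.
congr (_ * _); have [->|a0] := eqVneq a 0.
  rewrite [chi 0 * _](nontrivial_char0 mor nt) mulr0.
  under eq_bigr => x _ do rewrite sub0r -mulN1r chi'_mor.2 mulrCA.
  by rewrite -big_distrr /= sum_mul_char // mulr0.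
rewrite (reindex (fun x => a * x)) /=; last first.
  by exists (fun x => a^-1 * x) => x _; rewrite ?mulKf ?mulVKf.
rewrite big_distrl; apply: eq_bigr => x _ /=.
by rewrite -[X in X - _]mulr1 -mulrBr chi_mor.2 chi'_mor.2 mulrACA mulrC.
Qed.

(** Substituting [x = u y] turns the product into the sum of [chi u * psi ((u + 1) y)].
The sum over [y != 0] is [q - 1] for [u = -1] and [-1] for every other [u], and
the common part [-1] is cancelled by the sum of [chi]. *)
Lemma gauss_sum_inv chi psi : additive_char psi -> nontrivial_char psi ->
  GRing.monoid_morphism chi -> nontrivial_char chi ->
  gauss_sum chi psi * gauss_sum (fun x => (chi x)^-1) psi = chi (-1) * #|F|%:R.
Proof.
move=> psi_add psi_nt chi_mor chi_nt; have [psi0 psiD] := psi_add.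
have chi0 := nontrivial_char0 chi_mor chi_nt.
rewrite [RHS]mulrC [LHS]mulrC [LHS]big_distrl /=.
transitivity (\sum_(y | y != 0) \sum_u chi u * psi ((u + 1) * y)).
  rewrite (bigD1 0) //= chi0 invr0 !mul0r add0r; apply: eq_bigr => y y0.
  rewrite big_distrr /= (reindex (fun u => u * y)) /=; last first.
    by exists (fun u => u / y) => u _; rewrite ?mulfK ?divfK.
  apply: eq_bigr => u _; rewrite chi_mor.2 mulrDl mul1r psiD.
  by field; exact: mul_char_neq0.
have inner u : \sum_(y | y != 0) psi ((u + 1) * y) = (u == -1)%:R * #|F|%:R - 1.
  have -> : \sum_(y | y != 0) psi ((u + 1) * y) = \sum_y psi ((u + 1) * y) - 1.
    by rewrite [in RHS](bigD1 0) //= mulr0 psi0 [1 + _]addrC addrK.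
  rewrite -addr_eq0; have [->|u1] := eqVneq (u + 1) 0; last first.
    by rewrite sum_additive_char // mul0r.
  congr (_ - _); rewrite mul1r; under eq_bigr do rewrite mul0r psi0.
  by rewrite sumr_const.
rewrite exchange_big /=; under eq_bigr => u _ do rewrite -big_distrr /= inner mulrBr mulr1.
rewrite sumrB (sum_mul_char chi_mor chi_nt) subr0.
rewrite (bigD1 (-1)) //= eqxx mul1r big1 ?addr0 //.
  by rewrite mulrC.
by move=> u /negPf ->; rewrite mul0r mulr0.
Qed.

End GaussSums.

(** The Hasse-Davenport product formula for the quadratic character: factor
[G(chi)^2] and [G(chi) G(phi)] through Jacobi sums, compare the two Jacobi sums by
[jacobi_sum_diag], and cancel [G(chi)]. *)
Lemma gauss_sum_duplication (F : finFieldType) (C : fieldType)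
    (chi phi psi : F -> C) :
    2%:R != 0 :> F -> #|F|%:R != 0 :> C ->
    additive_char psi -> nontrivial_char psi ->
    GRing.monoid_morphism chi -> nontrivial_char (fun x => chi x ^+ 2) ->
    GRing.monoid_morphism phi -> quadratic_char phi ->
  chi 4%:R * gauss_sum chi psi * gauss_sum (fun x => chi x * phi x) psi
    = gauss_sum (fun x => chi x ^+ 2) psi * gauss_sum phi psi.
Proof.
move=> char2 qC psi_add psi_nt chi_mor chi2_nt phi_mor phi_quad.
have char4 : 4%:R != 0 :> F by rewrite (natrM _ 2 2) mulf_neq0.
have chi_nt : nontrivial_char chi.
  case: chi2_nt => a a0 chi2a; exists a => //.
  by apply: contraNneq chi2a => ->; rewrite expr1n.
have chiphi_nt : nontrivial_char (fun x => chi x * phi x).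
  case: chi2_nt => a a0 chi2a; exists a => //; apply: contraNneq chi2a => chiphi1.
  have: (chi a * phi a) ^+ 2 = 1 by rewrite chiphi1 expr1n.
  by rewrite exprMn phi_quad.2 //; case: ifP => _; rewrite ?sqrrN expr1n mulr1 => ->.
have N1 : -1 != 0 :> F by rewrite oppr_eq0 oner_neq0.
have G0 : gauss_sum chi psi != 0.
  apply: contraNneq (mulf_neq0 (mul_char_neq0 chi_mor N1) qC) => G0.
  by rewrite -(gauss_sum_inv psi_add psi_nt chi_mor chi_nt) G0 mul0r.
have sqG : gauss_sum chi psi * gauss_sum chi psi
    = (chi 4%:R)^-1 * jacobi_sum chi phi * gauss_sum (fun x => chi x ^+ 2) psi.
  by rewrite -jacobi_sum_diag // gauss_sumM.
have mixG := gauss_sumM psi_add chi_mor phi_mor chiphi_nt.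
apply: (mulfI G0); rewrite [RHS]mulrCA mixG.
rewrite (_ : forall a b c : C, a * (b * a * c) = b * (a * a) * c); last by move=> *; ring.
by rewrite sqG; field; exact: mul_char_neq0.
Qed.

(** * Existence of characters *)

(** Stated through a generator [gamma] of the cyclic group of nonzero elements, so
that statements on [chi] reduce to exponents of one primitive root of unity. *)
Definition exact_order (F : finFieldType) (C : fieldType) (m : nat) (chi : F -> C) :=
  exists gamma : F,
    [/\ gamma != 0, forall x, x != 0 -> exists k, x = gamma ^+ k
      & m.-primitive_root (chi gamma)].

Lemma expf_pred_card (F : finFieldType) (x : F) : x != 0 -> x ^+ #|F|.-1 = 1.
Proof.
move=> x0; apply: (mulfI x0); rewrite -exprS prednK ?expf_card ?mulr1 //.
exact: ltnW (finNzRing_gt1 F).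
Qed.

Lemma nat_mul_card (F : finFieldType) (x : F) : x *+ #|F| = 0.
Proof. by rewrite -FinRing.zmodXgE -cardsT expg_cardG ?inE. Qed.

Section Existence.
Variables (F : finFieldType) (C : numClosedFieldType).

Lemma prim_root_exists n : (0 < n)%N -> exists w : C, n.-primitive_root w.
Proof.
move=> n_gt0; pose p : {poly C} := 'X^n - 1.
have [rs pE] := closed_field_poly_normal p.
rewrite (monicP _) ?monicXnsubC // scale1r in pE.
have size_rs : size rs = n.
  by apply/eqP; rewrite -eqSS -(size_prod_XsubC rs id) -pE size_XnsubC.
have /hasP[w _ w_prim] : has n.-primitive_root rs; last by exists w.
apply: has_prim_root => //; last by rewrite size_rs.
  by apply/allP=> x; rewrite -root_prod_XsubC -pE.
rewrite -separable_prod_XsubC -pE separable_Xn_sub_1 //.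
by rewrite pnatr_eq0 -lt0n.
Qed.

(** Over the prime field [F] is a vector space, so some coordinate does not vanish at
[1]; compose that coordinate with a primitive [p]-th root of unity. *)
Lemma additive_char_exists :
  exists psi : F -> C, additive_char psi /\ nontrivial_char psi.
Proof.
have [p p_pr pcharF] := finPcharP F.
have [w w_prim] := prim_root_exists (prime_gt0 p_pr).
pose V : vectType 'F_p := pPrimeCharType pcharF.
pose coords := coord (vbasis (fullv : {vspace V})).
have /existsP[j coords1] : [exists j, coords j (1 : V) != 0].
  apply: contraNT (oner_neq0 F) => /existsPn coords0; apply/eqP.
  rewrite [LHS](coord_vbasis (memvf (1 : V))) big1 // => j _.
  by have /negPn/eqP := coords0 j; rewrite /coords => ->; rewrite scale0r.
exists (fun x => w ^+ (coords j (x : V))); split.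
  split=> [|x y]; first by rewrite [coords j _](linear0 (coords j)).
  rewrite [coords j _](linearD (coords j)) -exprD -[RHS](prim_expr_mod w_prim) /=.
  by congr (w ^+ (_ %% _)); exact: Fp_cast.
exists 1; first exact: oner_neq0.
rewrite -(prim_order_dvd w_prim) /dvdn modn_small //.
by rewrite -[X in (_ < X)%N](Fp_cast p_pr) ltn_ord.
Qed.

(** Send a generator of the nonzero elements to a primitive [m]-th root of unity. *)
Lemma mul_char_exists m : (0 < m)%N -> (m %| #|F|.-1)%N ->
  exists chi : F -> C, GRing.monoid_morphism chi /\ exact_order m chi.
Proof.
move=> m_gt0 m_dvd; have q_gt1 := finNzRing_gt1 F.
have q1_gt0 : (0 < #|F|.-1)%N by case: #|F| q_gt1 => [|[]].
have /hasP[gamma _ gamma_prim] : has #|F|.-1.-primitive_root (enum (predC1 (0 : F))).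
  apply: has_prim_root => //; last 2 first.
  - exact: enum_uniq.
  - by rewrite -cardE cardC1.
  by apply/allP=> x; rewrite mem_enum !inE => x0; rewrite unity_rootE expf_pred_card.
pose log (x : F) :=
  if [pick k : 'I_#|F|.-1 | x == gamma ^+ k] is Some k then k : nat else 0%N.
have logK x : x != 0 -> gamma ^+ log x = x.
  rewrite /log => /expf_pred_card /(prim_rootP gamma_prim) [k xE].
  by case: pickP => [? /eqP // | /(_ k)]; rewrite xE eqxx.
have [w w_prim] := prim_root_exists m_gt0.
(* Discrete logarithms matter modulo [q - 1] only, hence modulo its divisor [m]. *)
have w_eq i j : gamma ^+ i = gamma ^+ j -> w ^+ i = w ^+ j.
  move=> /eqP; rewrite (eq_prim_root_expr gamma_prim) => ij.
  apply/eqP; rewrite (eq_prim_root_expr w_prim) -(modn_dvdm i m_dvd).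
  by rewrite (eqP ij) modn_dvdm.
have gamma0 : gamma != 0.
  apply: contraNneq (oner_neq0 F) => g0.
  by rewrite -(prim_expr_order gamma_prim) g0 expr0n -(prednK q1_gt0).
exists (fun x => if x == 0 then 0 else w ^+ log x); split.
  split=> [|x y].
    by rewrite oner_eq0 (w_eq _ 0%N) // logK ?oner_neq0.
  rewrite mulf_eq0; case: eqVneq => [|x0]; first by rewrite mul0r.
  case: eqVneq => [|y0] /=; first by rewrite mulr0.
  by rewrite -exprD; apply: w_eq; rewrite exprD !logK ?mulf_neq0.
exists gamma; split=> // [x x0|]; first by exists (log x); rewrite logK.
by rewrite (negPf gamma0) (w_eq _ 1%N) // logK.
Qed.

End Existence.

(** * Characters of exact order m *)

Section ExactOrder.
Variables (F : finFieldType) (C : fieldType) (m : nat) (chi : F -> C).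
Hypotheses (chi_mor : GRing.monoid_morphism chi) (chi_ord : exact_order m chi).

Lemma exact_order_expr1 x : x != 0 -> chi x ^+ m = 1.
Proof.
case: chi_ord => gamma [gamma0 gen prim] /gen [k ->].
by rewrite mul_charX // exprAC (prim_expr_order prim) expr1n.
Qed.

(** For [d = m] this detects the [m]-th powers, and for [d = 2] the squares. *)
Lemma exact_order_kernel d e x : (0 < e)%N -> m = (d * e)%N -> x != 0 ->
  (chi x ^+ e == 1) = [exists y, x == y ^+ d].
Proof.
case: chi_ord => gamma [gamma0 gen prim] e0 mE x0; apply/eqP/existsP => [|[y /eqP xE]].
  have [k ->] := gen x x0; rewrite mul_charX // -exprM => /eqP.
  rewrite -(prim_order_dvd prim) mE dvdn_pmul2r // => /dvdnP[j ->].
  by exists (gamma ^+ j); rewrite exprM.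
rewrite xE mul_charX // -exprM -mE exact_order_expr1 //.
apply: contraNneq x0 => y0; rewrite xE y0 expr0n.
by have := prim_order_gt0 prim; rewrite mE muln_gt0 lt0n => /andP[/negPf->].
Qed.

Lemma nontrivial_char_expr s : (0 < s < m)%N -> nontrivial_char (fun x => chi x ^+ s).
Proof.
case: chi_ord => gamma [gamma0 gen prim] /andP[s0 sm]; exists gamma => //.
by rewrite -(prim_order_dvd prim) gtnNdvd.
Qed.

Lemma quadratic_char_half : ~~ odd m -> (0 < m)%N ->
  quadratic_char (fun x => chi x ^+ m./2).
Proof.
move=> m_even m0; have mE : m = (2 * m./2)%N by rewrite mul2n even_halfK.
have half0 : (0 < m./2)%N by rewrite half_gt0; case: (m) m0 m_even => [|[]].
split=> [|x x0].
  apply: (nontrivial_char0 (mul_char_exp _ chi_mor)).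
  by apply: nontrivial_char_expr; lia.
rewrite -(exact_order_kernel half0 mE x0); case: eqP => // ne1.
have: (chi x ^+ m./2) ^+ 2 == 1 by rewrite -exprM mulnC -mE exact_order_expr1.
by rewrite sqrf_eq1 => /orP[/eqP|/eqP].
Qed.

End ExactOrder.

(** * Absolute values of Gauss sums *)

Section AbsoluteValue.
Variables (F : finFieldType) (C : numClosedFieldType).
Implicit Types (chi psi : F -> C).

Lemma conj_unity n (z : C) : (0 < n)%N -> z ^+ n = 1 -> z^* = z^-1.
Proof.
move=> n0 zn; have /eqP z1 : `|z| == 1.
  by rewrite -(pexpr_eq1 n0) // -normrX zn normr1.
by rewrite invC_norm z1 expr1n invr1 mul1r.
Qed.

Lemma conj_mul_char chi x : GRing.monoid_morphism chi -> x != 0 -> (chi x)^* = (chi x)^-1.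
Proof.
move=> chi_mor x0; have q1 : (0 < #|F|.-1)%N.
  by case: #|F| (finNzRing_gt1 F) => [|[]].
by apply: (conj_unity q1); rewrite -mul_charX // expf_pred_card // chi_mor.1.
Qed.

Lemma additive_charN psi x : additive_char psi -> psi (- x) = (psi x)^-1.
Proof.
move=> [psi0 psiD]; have psix : psi x * psi (- x) = 1 by rewrite -psiD subrr.
have psix0 : psi x != 0.
  by apply: contraNneq (oner_neq0 C) => p0; rewrite -psix p0 mul0r.
by apply: (mulfI psix0); rewrite psix mulfV.
Qed.

Lemma conj_additive_char psi x : additive_char psi -> (psi x)^* = psi (- x).
Proof.
move=> psi_add; have [psi0 psiD] := psi_add.
have psiMn n : psi (x *+ n) = psi x ^+ n.
  by elim: n => [|n IH]; rewrite ?mulr0n ?psi0 // mulrS psiD IH exprS.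
rewrite additive_charN //; apply: (@conj_unity #|F|); first exact: ltnW (finNzRing_gt1 F).
by rewrite -psiMn nat_mul_card.
Qed.

(** Since [psi^* x = psi (- x)], the conjugate of [G(chi)] is [chi(-1) G(chi^-1)], and
the reflection formula applies. *)
Lemma norm_gauss_sum chi psi : additive_char psi -> nontrivial_char psi ->
  GRing.monoid_morphism chi -> nontrivial_char chi ->
  `|gauss_sum chi psi| ^+ 2 = #|F|%:R.
Proof.
move=> psi_add psi_nt chi_mor chi_nt; have N1 : -1 != 0 :> F by rewrite oppr_eq0 oner_neq0.
rewrite normCK.
have -> : (gauss_sum chi psi)^* = chi (-1) * gauss_sum (fun x => (chi x)^-1) psi.
  rewrite -[chi (-1)]invrK -(gauss_sum_scale psi (mul_char_inv chi_mor) N1) rmorph_sum.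
  apply: eq_bigr => x _; rewrite rmorphM /= (conj_additive_char x psi_add) mulN1r.
  have [->|x0] := eqVneq x 0; last by rewrite conj_mul_char.
  by rewrite (nontrivial_char0 chi_mor chi_nt) invr0 rmorph0.
rewrite mulrCA gauss_sum_inv // mulrA -chi_mor.2 mulrNN mulr1 chi_mor.1.
by rewrite mul1r.
Qed.

End AbsoluteValue.

(** * Difference sets *)

Section DifferenceSets.
Variables (F : finFieldType) (D : {set F}) (lambda : nat).
Hypothesis D_diff : forall a : F, a != 0 ->
  #|[set xy in setX D D | xy.1 - xy.2 == a]| = lambda.

(** The difference [0] arises from the [#|D|] diagonal pairs, every other one
[lambda] times. *)
Lemma diff_set_sum (C : comNzRingType) (f : F -> C) :
  \sum_(x in D) \sum_(y in D) f (x - y)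
    = (#|D|%:R - lambda%:R) * f 0 + lambda%:R * \sum_a f a.
Proof.
rewrite pair_big /= (partition_big (fun xy : F * F => xy.1 - xy.2) predT) //=.
transitivity (\sum_a #|[set xy in setX D D | xy.1 - xy.2 == a]|%:R * f a).
  apply: eq_bigr => a _; rewrite mulr_natl -sumr_const.
  apply: eq_big => [[x y]|[x y] /andP[_ /eqP <-]] //; by rewrite !inE.
rewrite (bigD1 0) //= (eq_bigr (fun a => lambda%:R * f a)); last by move=> a /D_diff ->.
have -> : #|[set xy in setX D D | xy.1 - xy.2 == 0]| = #|D|.
  rewrite -(card_imset D (_ : injective (fun x => (x, x)))); last by move=> x y [].
  apply: eq_card => -[x y]; rewrite !inE /= subr_eq0;
  apply/andP/imsetP => [[/andP[xD _] /eqP yE]|[z zD [-> ->]]].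
    by exists x; rewrite // yE.
  by rewrite zD eqxx.
by rewrite -big_distrr /= [\sum_a f a in RHS](bigD1 0) //=; ring.
Qed.

Lemma diff_set_card : (#|D| * #|D| + lambda = #|D| + lambda * #|F|)%N.
Proof.
apply/eqP; rewrite -(eqr_nat int) !natrD !natrM; apply/eqP.
have := diff_set_sum (fun => 1 : int); rewrite !sumr_const mulr1 mulr_natr => ->.
by rewrite cardT -cardE; ring.
Qed.

Lemma diff_set_fourier (C : fieldType) (psi : F -> C) b :
    additive_char psi -> nontrivial_char psi -> b != 0 ->
  (\sum_(x in D) psi (b * x)) * (\sum_(x in D) psi (- b * x)) = #|D|%:R - lambda%:R :> C.
Proof.
move=> psi_add psi_nt b0; rewrite big_distrl /=.
transitivity (\sum_(x in D) \sum_(y in D) psi (b * (x - y))).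
  apply: eq_bigr => x _; rewrite big_distrr; apply: eq_bigr => y _ /=.
  by rewrite -psi_add.2 mulrBr mulNr.
rewrite (diff_set_sum (fun a => psi (b * a))) sum_additive_char // mulr0 psi_add.1.
by rewrite mulr1 mulr0 addr0.
Qed.

End DifferenceSets.

(** * Polynomials with constant product on the roots of unity *)

Lemma sum_unity_expr (C : fieldType) (m : nat) (z : C) :
  z ^+ m = 1 -> \sum_(s < m) z ^+ s = (z == 1)%:R * m%:R.
Proof.
case: eqVneq => [-> _|z1 zm].
  by under eq_bigr do rewrite expr1n; rewrite sumr_const card_ord mul1r.
rewrite mul0r; apply: (mulfI (_ : z - 1 != 0)); first by rewrite subr_eq0.
by rewrite -subrX1 zm subrr mulr0.
Qed.

(** The dividend lies strictly between [0] and [3 m], so it is [m] or [2 m]. *)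
Lemma dvdn_cyclic_index m r s t : (0 < r < m)%N -> (s < m)%N -> (t < m)%N ->
  (m %| m - r + s + t)%N = (s == if t <= r then r - t else m + r - t)%N.
Proof.
move=> /andP[r0 rm] sm tm; apply/idP/eqP => [/dvdnP[k kE]|->].
  have : (0 < k < 3)%N.
    by case: k kE => [|[|[|k]]] //; rewrite ?mulSn; lia.
  by case: k kE => [|[|[|k]]] // kE _; case: leqP => ?; lia.
case: leqP => tr; apply/dvdnP; [exists 1%N | exists 2%N]; lia.
Qed.

(** The left-hand side is the coefficient of [z^r] in the product reduced modulo
[z^m - 1]; it is extracted by summing the product against [z^(m - r)], an inverse of
[z^r], over the powers [z] of [w]. *)
Lemma cyclic_convolution_const (C : numFieldType) (m r : nat) (w K : C)
    (c d : nat -> C) :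
  m.-primitive_root w -> (0 < r < m)%N ->
  (forall k, (\sum_(s < m) c s * (w ^+ k) ^+ s) * (\sum_(t < m) d t * (w ^+ k) ^+ t) = K) ->
  \sum_(0 <= t < r.+1) d t * c (r - t)%N
    + \sum_(r.+1 <= t < m) d t * c (m + r - t)%N = 0.
Proof.
move=> w_prim r_bd prodK; have /andP[r0 rm] := r_bd.
have m0 : (0 < m)%N := prim_order_gt0 w_prim.
have orth j : \sum_(k < m) (w ^+ k) ^+ j = (m %| j)%:R * m%:R.
  rewrite (prim_order_dvd w_prim) -(@sum_unity_expr _ m); last first.
    by rewrite exprAC (prim_expr_order w_prim) expr1n.
  by apply: eq_bigr => k _; rewrite exprAC.
have K0 : \sum_(k < m) K * (w ^+ k) ^+ (m - r) = 0.
  by rewrite -big_distrr /= orth gtnNdvd ?subn_gt0 // ?mul0r ?mulr0 // ltn_subrL r0.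
have mC : m%:R != 0 :> C by rewrite pnatr_eq0 -lt0n.
apply: (mulIf mC); rewrite mul0r -[RHS]K0.
pose idx t := (if t <= r then r - t else m + r - t)%N.
transitivity ((\sum_(0 <= t < m) d t * c (idx t)) * m%:R).
  congr (_ * _); rewrite [RHS](big_cat_nat (n := r.+1)) //=.
  by congr (_ + _); apply: eq_big_nat => t /andP[lo hi]; rewrite /idx;
    case: leqP => //; rewrite ?(leq_gtF lo) //; lia.
have prodE (k : 'I_m) : K * (w ^+ k) ^+ (m - r)
    = \sum_(s < m) \sum_(t < m) d t * c s * (w ^+ k) ^+ (m - r + s + t).
  rewrite -(prodK k) big_distrl /= big_distrl; apply: eq_bigr => s _ /=.
  rewrite big_distrr /= big_distrl; apply: eq_bigr => t _ /=.
  by rewrite !exprD; ring.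
rewrite (eq_bigr _ (fun k _ => prodE k)) exchange_big /= big_mkord.
transitivity (\sum_(s < m) \sum_(t < m) d t * c s * ((m %| m - r + s + t)%N%:R * m%:R)).
  rewrite exchange_big /= big_distrl; apply: eq_bigr => t _ /=.
  have idx_lt : (idx t < m)%N by rewrite /idx; have := ltn_ord t; case: (leqP t r); lia.
  rewrite (bigD1 (Ordinal idx_lt)) //= dvdn_cyclic_index // eqxx mul1r big1 ?addr0 //.
  move=> s sNidx; rewrite dvdn_cyclic_index //.
  case: eqP => [sE|]; last by rewrite mul0r mulr0.
  by case/eqP: sNidx; apply: val_inj.
apply: eq_bigr => s _; rewrite [RHS]exchange_big; apply: eq_bigr => t _ /=.
by rewrite -big_distrr /= orth.
Qed.

(** * The set of m-th powers *)

Section PowerResidues.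
Variables (F : finFieldType) (C : numFieldType) (m : nat) (D : {set F}).
Variables (chi psi : F -> C).
Hypotheses (chi_mor : GRing.monoid_morphism chi) (chi_ord : exact_order m chi).
Hypothesis D_powers : forall x : F, x != 0 -> (x \in D) = [exists y, x == y ^+ m].

Lemma power_indicator x : x != 0 -> m%:R * (x \in D)%:R = \sum_(s < m) chi x ^+ s.
Proof.
move=> x0; rewrite sum_unity_expr ?(exact_order_expr1 chi_mor chi_ord) // mulrC.
by rewrite D_powers // -(exact_order_kernel chi_mor chi_ord (ltn0Sn 0)) ?muln1 // expr1.
Qed.

(** Sum [power_indicator] over the nonzero [x]: only [s = 0] contributes. *)
Lemma card_powers : (m * #|D :\ 0%R| = #|F|.-1)%N.
Proof.
have m0 : (0 < m)%N by case: chi_ord => gamma [_ _ /prim_order_gt0].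
apply/eqP; rewrite -(eqr_nat C) natrM -sum1_card natr_sum big_distrr /=.
rewrite (eq_bigl (fun x => (x != 0) && (x \in D))); last by move=> x; rewrite !inE.
rewrite big_mkcondr (eq_bigr (fun x => \sum_(s < m) chi x ^+ s)) /=; last first.
  by move=> x /power_indicator <-; case: (x \in D); rewrite ?mulr0.
rewrite exchange_big (bigD1 (Ordinal m0)) //= [X in _ + X]big1 ?addr0 => [|s s0].
  by rewrite -(cardC1 (0 : F)) -sum1_card natr_sum; apply/eqP/eq_big.
have s_bd : (0 < s < m)%N by rewrite ltn_ord lt0n andbT.
have nt := nontrivial_char_expr chi_ord s_bd; have mor := mul_char_exp s chi_mor.
have := sum_mul_char mor nt; rewrite (bigD1 0) //=.
by rewrite [chi 0 ^+ s](nontrivial_char0 mor nt) add0r.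
Qed.

(** The Gauss sum at [s = 0] would be taken over all of [F] and vanish; restricted to
nonzero elements it is [-1], and [0 \in D] adds [m]. *)
Definition period_coef s : C :=
  if s == 0%N then m%:R * (0 \in D)%:R - 1 else gauss_sum (fun x => chi x ^+ s) psi.

(** On nonzero [x], the average of the [chi x ^+ s] is the indicator of [D], and scaling
the variable by [b^-1] takes [chi b ^+ s] out of the [s]-th Gauss sum. *)
Lemma period_expansion b : additive_char psi -> nontrivial_char psi -> b != 0 ->
  m%:R * (\sum_(x in D) psi (b^-1 * x)) = \sum_(s < m) period_coef s * chi b ^+ s.
Proof.
move=> psi_add psi_nt b0; have bV0 : b^-1 != 0 by rewrite invr_eq0.
have m0 : (0 < m)%N by case: chi_ord => gamma [_ _ /prim_order_gt0].
have sum0 : \sum_(x | x != 0) psi (b^-1 * x) = -1.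
  have := sum_additive_char psi_add psi_nt bV0; rewrite (bigD1 0) //= mulr0 psi_add.1.
  by move/eqP; rewrite addrC addr_eq0 => /eqP.
have sumD : m%:R * (\sum_(x in D) psi (b^-1 * x)) = m%:R * (0 \in D)%:R
    + \sum_(s < m) \sum_(x | x != 0) chi x ^+ s * psi (b^-1 * x).
  rewrite big_mkcond (bigD1 0) //= mulr0 psi_add.1 mulrDr; congr (_ + _).
    by case: (0 \in D).
  rewrite big_distrr /= exchange_big; apply: eq_bigr => x x0 /=.
  rewrite -big_distrl /= -power_indicator //.
  by case: (x \in D); rewrite ?mulr1 // !mulr0 mul0r.
rewrite sumD !(bigD1 (Ordinal m0) (P := predT)) //= /period_coef /=.
under [in LHS]eq_bigr do rewrite expr0 mul1r.
rewrite sum0 addrA expr0 mulr1; congr (_ + _); apply: eq_bigr => s s0.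
have s_bd : (0 < s < m)%N by rewrite ltn_ord lt0n andbT.
have nt := nontrivial_char_expr chi_ord s_bd; have mor := mul_char_exp s chi_mor.
rewrite ifN ?lt0n //; transitivity (\sum_x chi x ^+ s * psi (b^-1 * x)).
  by rewrite [RHS](bigD1 0) //= [chi 0 ^+ s](nontrivial_char0 mor nt) mul0r add0r.
by rewrite (gauss_sum_scale psi mor bV0) /= mul_charV // exprVn invrK mulrC.
Qed.

End PowerResidues.

(** In [F], [q] is zero; if [2] were zero too, the odd [q] would be [1]. *)
Lemma two_neq0_finField (F : finFieldType) : odd #|F| -> 2%:R != 0 :> F.
Proof.
move=> q_odd; apply: contraNneq (oner_neq0 F) => two0.
have := nat_mul_card (1 : F); rewrite -{1}[#|F|]odd_double_half q_odd.
by rewrite -mul2n natrD natrM two0 mul0r addr0 => <-.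
Qed.

(** The hypothesis is the count of the [|D|^2] differences of a set with [f + e]
elements, [e] telling whether it contains [0].  Divided by [f], it reads
[f + 2 e = 1 + lambda m]. *)
Lemma odd_residue_degree (m f e lambda : nat) : (0 < f)%N -> ~~ odd m -> (e <= 1)%N ->
  ((f + e) * (f + e) + lambda = f + e + lambda * (m * f + 1))%N -> odd f.
Proof.
move=> f0 m_even e1 cardE.
suff : (f + e.*2 = 1 + lambda * m)%N.
  move/(congr1 odd); rewrite !oddD odd_double oddM (negPf m_even) andbF addbF.
  by move->.
apply/eqP; rewrite -(eqn_pmul2l f0); apply/eqP.
by case: e e1 cardE => [|[|e]] // _; rewrite ?double0 -?muln2; nia.
Qed.

(** Otherwise [-1] is an [m]-th power, so its [f]-th power is [1], although [f] is
odd. *)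
Lemma char_minus1 (F : finFieldType) (C : fieldType) (chi : F -> C) (m f : nat) :
  GRing.monoid_morphism chi -> exact_order m chi -> #|F|.-1 = (m * f)%N ->
  odd f -> 2%:R != 0 :> F -> chi (-1) = -1.
Proof.
move=> chi_mor chi_ord cardF f_odd char2.
have N1 : -1 != 0 :> F by rewrite oppr_eq0 oner_neq0.
have: chi (-1) ^+ 2 == 1 by rewrite -mul_charX // sqrrN expr1n chi_mor.1.
rewrite sqrf_eq1 => /orP[chi1|/eqP //]; case/negP: char2.
have := exact_order_kernel chi_mor chi_ord (ltn0Sn 0) (esym (muln1 m)) N1.
rewrite expr1 chi1 => /esym/existsP[y /eqP yE].
have y0 : y != 0.
  apply: contraNneq N1 => y0; rewrite yE y0 expr0n.
  by case: chi_ord => gamma [_ _ /prim_order_gt0]; case: (m).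
have: (-1) ^+ f = 1 :> F by rewrite yE -exprM -cardF expf_pred_card.
by rewrite -signr_odd f_odd expr1 => N11; rewrite mulr2n -{1}N11 addNr.
Qed.

(** * The system of equations *)

Section GaussSumRelations.
Variables (F : finFieldType) (C : numFieldType) (m : nat) (chi psi : F -> C).
Hypotheses (chi_mor : GRing.monoid_morphism chi) (chi_ord : exact_order m chi).
Hypotheses (psi_add : additive_char psi) (psi_nt : nontrivial_char psi).
Hypothesis chiN1 : chi (-1) = -1.
Local Notation G s := (gauss_sum (fun x => chi x ^+ s) psi).

Lemma gauss_sum_reflection s : (0 < s < m)%N ->
  G s * G (m - s)%N = (-1) ^+ s * #|F|%:R.
Proof.
move=> s_bd; have [mor nt] := (mul_char_exp s chi_mor, nontrivial_char_expr chi_ord s_bd).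
rewrite -chiN1 -(gauss_sum_inv psi_add psi_nt mor nt); congr (_ * _).
apply: eq_bigr => x _; congr (_ * _); have [->|x0] := eqVneq x 0.
  have ms_bd : (0 < m - s < m)%N by lia.
  rewrite [chi 0 ^+ s](nontrivial_char0 mor nt) invr0.
  exact: nontrivial_char0 (mul_char_exp _ chi_mor) (nontrivial_char_expr chi_ord ms_bd).
have chix0 := mul_char_neq0 mor x0.
apply: (mulfI chix0); rewrite mulfV // -exprD subnKC ?exact_order_expr1 //; lia.
Qed.

Lemma gauss_sum_half_shift s : 2%:R != 0 :> F -> ~~ odd m -> (0 < 2 * s < m)%N ->
  chi 4%:R ^+ s * G s * G (m./2 + s)%N = G (2 * s)%N * G m./2.
Proof.
move=> char2 m_even s_bd; have m0 : (0 < m)%N by lia.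
have phi_quad := quadratic_char_half chi_mor chi_ord m_even m0.
have nt2 : nontrivial_char (fun x => (chi x ^+ s) ^+ 2).
  have [a a0 ne1] := nontrivial_char_expr chi_ord s_bd.
  by exists a; rewrite // -exprM mulnC.
have qC : #|F|%:R != 0 :> C by rewrite pnatr_eq0 -lt0n ltnW // finNzRing_gt1.
have := gauss_sum_duplication char2 qC psi_add psi_nt (mul_char_exp s chi_mor) nt2
  (mul_char_exp _ chi_mor) phi_quad.
have -> : gauss_sum (fun x => (chi x ^+ s) ^+ 2) psi = G (2 * s)%N.
  by apply: eq_bigr => x _; rewrite -exprM mulnC.
suff -> : gauss_sum (fun x => chi x ^+ s * chi x ^+ m./2) psi = G (m./2 + s)%N by [].
by apply: eq_bigr => x _; rewrite -exprD addnC.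
Qed.

(** By [period_expansion] at [gamma ^+ k] and at its opposite, the polynomial with
coefficients [c] takes the values [m eta(1/b)] and [m eta(-1/b)] at [z = chi b] and
[- z], for [b = gamma ^+ k]; their product is constant by [diff_set_fourier]. *)
Lemma period_coef_convolution (D : {set F}) lambda r :
    (forall x : F, x != 0 -> (x \in D) = [exists y, x == y ^+ m]) ->
    (forall a : F, a != 0 -> #|[set xy in setX D D | xy.1 - xy.2 == a]| = lambda) ->
    (0 < r < m)%N ->
  let c := period_coef m D chi psi in
  \sum_(0 <= t < r.+1) (-1) ^+ t * c t * c (r - t)%N
    + \sum_(r.+1 <= t < m) (-1) ^+ t * c t * c (m + r - t)%N = 0.
Proof.
move=> D_powers D_diff r_bd c; have [gamma [gamma0 _ w_prim]] := chi_ord.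
apply: (cyclic_convolution_const (d := fun t => (-1) ^+ t * c t)
  (K := m%:R ^+ 2 * (#|D|%:R - lambda%:R)) w_prim r_bd) => k.
have b0 : gamma ^+ k != 0 by rewrite expf_neq0.
have Nb0 : - gamma ^+ k != 0 by rewrite oppr_eq0.
have expand := period_expansion chi_mor chi_ord D_powers psi_add psi_nt.
rewrite -mul_charX // -expand //.
rewrite (eq_bigr (fun t : 'I_m => c t * chi (- gamma ^+ k) ^+ t)); last first.
  move=> t _; rewrite -[- _ ^+ k]mulN1r chi_mor.2 chiN1 exprMn mul_charX //.
  by rewrite mulrCA mulrA.
rewrite -expand // mulrACA -expr2 invrN; congr (_ * _).
by rewrite (diff_set_fourier D_diff psi_add psi_nt) ?invr_eq0.
Qed.

End GaussSumRelations.

Local Open Scope complex_scope.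

(** The two sets of the theorem have the same nonzero elements, and [0 \in D] enters
only through the constant coefficient [period_coef m D chi psi 0]. *)
Lemma residue_difference_set_solution (R : realType) (m f : nat) (F : finFieldType)
    (D : {set F}) :
  (0 < m)%N -> (0 < f)%N -> #|F| = (m * f + 1)%N -> ~~ odd m ->
  (forall x : F, x != 0 -> (x \in D) = [exists y, x == y ^+ m]) ->
  difference_set D ->
  exists (g : m.-tuple R[i]) (h : R[i]),
    [/\ is_solution g h, in_domain g h
      & g`_0 = ((m%:R * (0 \in D)%:R - 1) / Num.sqrt (#|F|%:R : R))%:C].
Proof.
move=> m0 f0 cardF m_even D_powers [lambda D_diff]; set q := #|F|.
have m_half : (m = 2 * m./2)%N by rewrite mul2n even_halfK.
have q1E : #|F|.-1 = (m * f)%N by rewrite cardF addn1.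
have char2 : 2%:R != 0 :> F.
  by apply: two_neq0_finField; rewrite cardF oddD oddM (negPf m_even).
have [psi [psi_add psi_nt]] := additive_char_exists F R[i].
have [|chi [chi_mor chi_ord]] := @mul_char_exists F R[i] m m0.
  by rewrite q1E dvdn_mulr.
have f_odd : odd f.
  apply: (@odd_residue_degree m f (0%R \in D) lambda) => //; first by case: (0 \in D).
  have cardD : #|D| = (f + (0%R \in D))%N.
    rewrite (cardsD1 0 D) addnC; congr (_ + _)%N; apply/eqP.
    by rewrite -(eqn_pmul2l m0) -q1E (card_powers chi_mor chi_ord D_powers).
  by rewrite -cardD -cardF (diff_set_card D_diff).
have chiN1 := char_minus1 chi_mor chi_ord q1E f_odd char2.
pose c := period_coef m D chi psi; pose G s := gauss_sum (fun x => chi x ^+ s) psi.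
have cE s : (0 < s)%N -> c s = G s by case: s.
pose sq : R[i] := (Num.sqrt (q%:R : R))%:C.
have qC : q%:R != 0 :> R[i] by rewrite pnatr_eq0 /q cardF addn1.
have sq_sqr : sq ^+ 2 = q%:R by rewrite /sq -rmorphXn /= sqr_sqrtr ?ler0n // rmorph_nat.
pose g := [tuple c i / sq | i < m]; pose h := chi 4%:R.
have gE s : (s < m)%N -> g`_s = c s / sq.
  by move=> sm; rewrite (nth_mktuple _ 0 (Ordinal sm)).
have g_pair (e u v : R[i]) : e * (u / sq) * (v / sq) = e * u * v / q%:R.
  by rewrite -sq_sqr expr2 invfM; ring.
have g0E : g`_0 = ((m%:R * (0 \in D)%:R - 1) / Num.sqrt (q%:R : R))%:C.
  rewrite gE // /c /period_coef /= /sq -fmorphV rmorphM /=; congr (_ * _).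
  by rewrite rmorphB rmorphM !rmorph_nat rmorph1.
have char4 : 4%:R != 0 :> F by rewrite (natrM _ 2 2) mulf_neq0.
have h_unity : h ^+ m./2 = 1.
  (* This is [chi 2 ^+ m], as [4 = 2 * 2]. *)
  rewrite /h (natrM _ 2 2) chi_mor.2 -expr2 -exprM -m_half.
  exact: exact_order_expr1.
have norm_G s : (0 < s < m)%N -> `|G s / sq| = 1.
  move=> s_bd; apply/eqP; rewrite -(@pexpr_eq1 _ _ 2) // normrM normfV exprMn exprVn.
  have -> : `|sq| ^+ 2 = q%:R by rewrite -normrX sq_sqr normr_nat.
  have nt := nontrivial_char_expr chi_ord s_bd.
  by rewrite (norm_gauss_sum psi_add psi_nt (mul_char_exp s chi_mor) nt) divff.
exists g, h; split; [split=> // | split | exact: g0E].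
- move=> s s_bd; have r_bd : (0 < 2 * s < m)%N by lia.
  have conv := period_coef_convolution chi_mor chi_ord psi_add psi_nt chiN1
    D_powers D_diff r_bd.
  rewrite -[RHS](mul0r q%:R^-1) -[X in _ = X * _]conv mulrDl !big_distrl /=.
  by congr (_ + _); apply: eq_big_nat => t t_bd; rewrite !gE ?g_pair //; lia.
- move=> s s_bd; rewrite !gE ?cE; try lia.
  rewrite -[LHS]mul1r mulrA g_pair mul1r /G.
  by rewrite (gauss_sum_reflection chi_mor chi_ord) ?mulfK //; lia.
- move=> s s_bd; rewrite !gE ?cE; try lia.
  rewrite g_pair -[RHS]mul1r mulrA g_pair mul1r; congr (_ / _).
  by rewrite /G (gauss_sum_half_shift chi_mor chi_ord) //; lia.
- by rewrite g0E; apply/complex_realP; eexists.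
- by move=> s s_bd; rewrite /unit_circle gE ?cE ?norm_G //; lia.
- apply/eqP; rewrite -(@pexpr_eq1 _ _ m./2) ?normr_ge0 //; last by lia.
  by rewrite -normrX h_unity normr1.
Qed.

Theorem theorem4p2 (R : realType) (q m f : nat) (F : finFieldType)
    (m_gt0 : (0 < m)%N) (f_gt0 : (0 < f)%N) (q_eq : q = (m * f + 1)%N)
    (cardF : #|F| = q) (m_even : ~~ odd m) :
  (difference_set (nonzero_powers F m) ->
     exists (g : m.-tuple R[i]) (h : R[i]),
       [/\ is_solution g h, in_domain g h
         & g`_0 = (- 1 / Num.sqrt (q%:R : R))%:C])
  /\
  (difference_set (powers_with_zero F m) ->
     exists (g : m.-tuple R[i]) (h : R[i]),
       [/\ is_solution g h, in_domain g h
         & g`_0 = ((m%:R - 1) / Num.sqrt (q%:R : R))%:C]).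
Proof.
have H_powers (x : F) : x != 0 ->
    (x \in nonzero_powers F m) = [exists y, x == y ^+ m].
  move=> x0; rewrite !inE x0; apply/imsetP/existsP => [[y _ ->]|[y /eqP xE]].
    by exists y.
  by exists y.
have M_powers (x : F) : x != 0 ->
    (x \in powers_with_zero F m) = [exists y, x == y ^+ m].
  by move=> x0; rewrite in_setU1 (negPf x0) H_powers.
have H0 : (0 \in nonzero_powers F m) = false by rewrite !inE eqxx.
have M0 : 0 \in powers_with_zero F m by rewrite !inE eqxx.
have cardE : #|F| = (m * f + 1)%N by rewrite cardF.
split=> D_diff.
  have [g [h [sol dom g0]]] :=
    residue_difference_set_solution R m_gt0 f_gt0 cardE m_even H_powers D_diff.
  by exists g, h; split=> //; rewrite g0 H0 mulr0 sub0r cardF.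
have [g [h [sol dom g0]]] :=
  residue_difference_set_solution R m_gt0 f_gt0 cardE m_even M_powers D_diff.
by exists g, h; split=> //; rewrite g0 M0 mulr1 cardF.
Qed.
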